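(* Let $G$ be an infinite group with identity $e$, let $n \geq 1$, and let $G = A_1 \cup \ldots \cup A_n$, where $A_i = A_i^{-1}$ and $e \in A_i$ for every $i \in \{1,\ldots,n\}$. Then there exist an $i \in \{1,\ldots,n\}$ and an infinite subset $X$ of $G$ such that $X \subseteq A_i$ and $\Delta(X) \subseteq A_i$.
   Context: For a subset $A$ of an infinite group $G$, $\Delta(A) = \{g \in G : |gA \cap A| = \infty\}$, where $gA = \{ga : a \in A\}$. Also $A^{-1} = \{a^{-1} : a \in A\}$. *)

(* Defs.v *)
From mathcomp Require Import all_boot.
From mathcomp Require Import boolp classical_sets functions cardinality.

Set Implicit Arguments.
Unset Strict Implicit.
Unset Printing Implicit Defensive.

Local Open Scope group_scope.
Local Open Scope classical_set_scope.

(* Groups are [groupType]s, which carry a choice structure; classically this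
   is no restriction on the underlying type. *)

Definition ltranslate (G : groupType) (g : G) (A : set G) : set G :=
  [set g * a | a in A].

Definition set_inv (G : groupType) (A : set G) : set G :=
  [set a^-1 | a in A].

Definition Delta (G : groupType) (A : set G) : set G :=
  [set g : G | infinite_set (ltranslate g A `&` A)].

(* Main.v *)
Require Import Defs.
From mathcomp Require Import all_boot.
From mathcomp Require Import boolp classical_sets functions cardinality.
From mathcomp Require Import filter.

(** Colour the pair {x, y} of group elements by an index i such that x * y^-1
    lies in A i; symmetry of the A i makes this independent of the order of
    x and y.  The infinite Ramsey theorem [ramsey_pairs] gives an index i and
    an infinite set Y with x * y^-1 in A i for all x and y in Y.  Fix b in Y
    and put X := Y * b^-1.  Then X is infinite and contained in A i, and since
    quotients are insensitive to right translation,
    Delta X is contained in X * X^-1 = Y * Y^-1, hence in A i.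

    Ramsey's theorem is obtained from a nonprincipal ultrafilter U: each point
    x has a colour i for which U-almost every y satisfies R i x y, and one
    colour i occurs in this way for U-almost every x.  A finite homogeneous
    set of such points x can always be enlarged, so a maximal one, provided by
    Zorn's lemma, is infinite. *)

Local Open Scope group_scope.
Local Open Scope classical_set_scope.

Lemma ultra_pigeonhole (T : Type) (I : finType) (F : set_system T)
    (P : I -> set T) :
  UltraFilter F -> (forall x, exists i, P i x) -> exists i, F (P i).
Proof.
move=> FU Pcover; apply: contrapT => noP.
have FC : \forall x \near F, forall i, ~ P i x.
  apply: filter_forall => i.
  by have [FPi|//] := in_ultra_setVsetC (P i) FU; case: noP; exists i.
have [x xP] := filter_ex FC.
by have [i /xP] := Pcover x.
Qed.

(** Colours are relations that cover the square and may overlap.  Asking them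
    to be reflexive lets homogeneity of Y range over all of Y * Y, diagonal
    included. *)
Lemma ramsey_pairs (T : choiceType) (I : finType) (R : I -> T -> T -> Prop) :
  infinite_set [set: T] ->
  (forall i x, R i x x) ->
  (forall i x y, R i x y -> R i y x) ->
  (forall x y, exists i, R i x y) ->
  exists i (Y : set T),
    infinite_set Y /\ (forall x y, Y x -> Y y -> R i x y).
Proof.
move=> Tinf Rrefl Rsym Rcover.
have [U [UU cofU]] := ultraFilterLemma (frechet_properfilter Tinf).
have [i US] : exists i, U [set x | U (R i x)].
  by apply: ultra_pigeonhole => x; apply: ultra_pigeonhole.
(* Homogeneous sets are confined to S so that almost every point is R i-related
   to each of their members, which leaves room for an extension. *)
set S := [set x | U (R i x)] in US.
pose homogeneous (Y : set T) :=
  Y `<=` S /\ forall x y, Y x -> Y y -> R i x y.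
have [|Y [[YS YR] Ymax]] := @Zorn_bigcup T homogeneous.
  move=> C Chom Ctot; split=> [x [Y CY Yx]|x y [X CX Xx] [Y CY Yy]].
    exact: (Chom Y CY).1.
  have [XY|YX] := Ctot X Y CX CY.
    by apply: (Chom Y CY).2 => //; apply: XY.
  by apply: (Chom X CX).2 => //; apply: YX.
exists i, Y; split=> // Yfin.
have UY : U (~` Y) by apply: cofU; rewrite /frechet_filter /= setCK.
have UR : U (\bigcap_(y in Y) R i y).
  have /finite_fsetP[D YD] := Yfin.
  by rewrite YD; apply: filter_bigI => y Dy; apply: YS; rewrite YD.
(* Almost every z extends Y, because Y is finite and U is nonprincipal. *)
have [z [[Sz Rz] nYz]] := filter_ex (filterI (filterI US UR) UY).
apply: (Ymax (Y `|` [set z])).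
  by split=> [x Yx|/(_ z)]; [left|move/(_ (or_intror erefl))].
split=> [x [/YS//|->//]|x y [Yx|->] [Yy|->]] //.
- exact: YR.
- by apply: Rz.
- by apply/Rsym/Rz.
Qed.

Theorem corollary14 (G : groupType) (hG : infinite_set [set: G])
    (n : nat) (hn : (1 <= n)%N) (A : 'I_n -> set G)
    (hcover : [set: G] = \bigcup_(i in [set: 'I_n]) A i)
    (hsym : forall i, A i = set_inv (A i))
    (hone : forall i, A i 1) :
  exists (i : 'I_n) (X : set G),
    [/\ infinite_set X, X `<=` A i & Delta X `<=` A i].
Proof.
have [|||i [Y [Yinf YA]]] :=
    @ramsey_pairs G 'I_n (fun i x y => A i (x * y^-1)) hG.
- by move=> i x; rewrite mulgV.
- move=> i x y Axy; rewrite hsym.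
  by exists (x * y^-1) => //; rewrite invgM invgK.
- move=> x y; have : [set: G] (x * y^-1) by [].
  by rewrite hcover => -[i _ Ai]; exists i.
have [b Yb] := infinite_setN0 Yinf.
exists i, [set y * b^-1 | y in Y]; split.
- apply: contra_not Yinf => Xfin.
  apply: sub_finite_set (finite_image (fun x => x * b) Xfin) => y Yy.
  by exists (y * b^-1); [exists y|rewrite mulgVK].
- by move=> _ [y Yy <-]; apply: YA.
- move=> g /infinite_setN0[_ [[_ [y Yy <-] <-] [y' Yy' y'E]]].
  have -> : g = y' * y^-1.
    by apply: (mulIg y); rewrite mulgVK; apply: (mulIg b^-1); rewrite y'E mulgA.
  exact: YA.
Qed.
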